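(* Let $\mathcal M$ and $\mathcal N=\{N^{(\lambda)}:\lambda\in\mathbb R_{>0}\}$ be two quasianalytic weight matrices such that $\sup_{k\in\mathbb N_{>0}}(n^{(\lambda)}_k)^{1/k}=+\infty$ for all $\lambda>0$ (Roumieu case) resp. $\lim_{k\to+\infty}(n^{(\lambda)}_k)^{1/k}=+\infty$ for all $\lambda>0$ (Beurling case). Then $j^\infty(\mathcal E^{0,r}_{\{\mathcal M\}})\cap\Lambda^r_{[\mathcal N]}\subsetneq\Lambda^r_{[\mathcal N]}$ (and hence also $j^\infty(\mathcal E^{0,r}_{(\mathcal M)})\cap\Lambda^r_{[\mathcal N]}\subsetneq\Lambda^r_{[\mathcal N]}$). In particular the Borel map $j^\infty:\mathcal E^{0,r}_{[\mathcal N]}\to\Lambda^r_{[\mathcal N]}$ is not surjective.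
   Context: For a sequence $M=(M_p)_{p\in\mathbb N}$ of positive reals write $m_p:=M_p/p!$. $M$ is a weight sequence if $1=M_0\le M_1$, $M_p^2\le M_{p-1}M_{p+1}$ for all $p\ge1$, and $\liminf_{p\to\infty}m_p^{1/p}>0$; it is quasianalytic if $\sum_{p\ge1}M_{p-1}/M_p=+\infty$. A weight matrix is a family $\mathcal M=\{M^{(\lambda)}:\lambda\in\mathbb R_{>0}\}$ of weight sequences with $M^{(\lambda)}_p\le M^{(\kappa)}_p$ for all $p$ whenever $\lambda\le\kappa$; write $n^{(\lambda)}_p:=N^{(\lambda)}_p/p!$. It is quasianalytic if every member is quasianalytic. For $U\subseteq\mathbb R^r$ open, $K\subseteq U$ compact, $h>0$: $\|f\|^M_{K,h}:=\sup_{\alpha\in\mathbb N^r,x\in K}|\partial^\alpha f(x)|/(h^{|\alpha|}M_{|\alpha|})$. $\mathcal E_{\{\mathcal M\}}(U)$: smooth $f$ such that for every compact $K\subseteq U$ there exist $\lambda>0$, $h>0$ with $\|f\|^{M^{(\lambda)}}_{K,h}<\infty$; $\mathcal E_{(\mathcal M)}(U)$: smooth $f$ with $\|f\|^{M^{(\lambda)}}_{K,h}<\infty$ for all compact $K$, all $\lambda>0$, all $h>0$. $\mathcal E^{0,r}_{\{\mathcal M\}}$, $\mathcal E^{0,r}_{(\mathcal M)}$ are the corresponding spaces of germs at $0\in\mathbb R^r$ (functions in the class on some cube $(-1/k,1/k)^r$). For $\mathbf b=(b_\alpha)_{\alpha\in\mathbb N^r}$, a weight sequence $N$, $h>0$: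 $|\mathbf b|^N_h:=\sup_\alpha|b_\alpha|/(h^{|\alpha|}n_{|\alpha|})$; $\Lambda^r_{\{\mathcal N\}}:=\{\mathbf b:\exists\lambda>0\,\exists h>0,\ |\mathbf b|^{N^{(\lambda)}}_h<\infty\}$, $\Lambda^r_{(\mathcal N)}:=\{\mathbf b:\forall\lambda>0\,\forall h>0,\ |\mathbf b|^{N^{(\lambda)}}_h<\infty\}$. The Borel map is $j^\infty(f)=(\partial^\alpha f(0)/|\alpha|!)_{\alpha\in\mathbb N^r}$. $[\cdot]$ means $\{\cdot\}$ throughout or $(\cdot)$ throughout. *)

(* Defs.v *)
From Stdlib Require Import Reals Arith.
Open Scope R_scope.

Definition small (M : nat -> R) (p : nat) : R := M p / INR (fact p).

Definition weight_sequence (M : nat -> R) : Prop :=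
  (forall p, 0 < M p) /\
  M 0%nat = 1 /\ 1 <= M 1%nat /\
  (forall p, (1 <= p)%nat -> (M p) ^ 2 <= M (p - 1)%nat * M (p + 1)%nat) /\
  (exists c, 0 < c /\ exists P, forall p, (P <= p)%nat -> (1 <= p)%nat ->
       c <= Rpower (small M p) (/ INR p)).

(* sum_{p>=1} M_{p-1}/M_p = +oo  (partial sums unbounded; terms are positive) *)
Definition quasianalytic (M : nat -> R) : Prop :=
  forall B : R, exists n : nat, B < sum_f_R0 (fun k => M k / M (S k)) n.

Definition weight_matrix (M : R -> nat -> R) : Prop :=
  (forall lam, 0 < lam -> weight_sequence (M lam)) /\
  (forall lam kap, 0 < lam -> lam <= kap -> forall p, M lam p <= M kap p).

Definition quasianalytic_matrix (M : R -> nat -> R) : Prop :=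
  forall lam, 0 < lam -> quasianalytic (M lam).

Definition inRr (r : nat) (x : nat -> R) : Prop := forall i, (r <= i)%nat -> x i = 0.

Definition multi_index (r : nat) (a : nat -> nat) : Prop :=
  forall i, (r <= i)%nat -> a i = 0%nat.

Fixpoint mlen (r : nat) (a : nat -> nat) : nat :=
  match r with O => O | S r' => (a r' + mlen r' a)%nat end.

Definition mzero : nat -> nat := fun _ => 0%nat.
Definition incr (a : nat -> nat) (i : nat) : nat -> nat :=
  fun j => if Nat.eqb j i then S (a j) else a j.
Definition upd (x : nat -> R) (i : nat) (t : R) : nat -> R :=
  fun j => if Nat.eqb j i then t else x j.
Definition origin : nat -> R := fun _ => 0.

Definition open_cube (r k : nat) (x : nat -> R) : Prop :=
  inRr r x /\ forall i, (i < r)%nat -> Rabs (x i) < / INR k.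
Definition closed_cube (r : nat) (c : R) (x : nat -> R) : Prop :=
  inRr r x /\ forall i, (i < r)%nat -> Rabs (x i) <= c.

Definition cont_on (r : nat) (S : (nat -> R) -> Prop) (g : (nat -> R) -> R) : Prop :=
  forall x, S x -> forall eps, 0 < eps -> exists delta, 0 < delta /\
    forall y, S y -> (forall i, (i < r)%nat -> Rabs (y i - x i) < delta) ->
      Rabs (g y - g x) < eps.

Definition smooth_with_derivs (r : nat) (U : (nat -> R) -> Prop)
    (f : (nat -> R) -> R) (D : (nat -> nat) -> (nat -> R) -> R) : Prop :=
  (forall x, U x -> D mzero x = f x) /\
  (forall a, multi_index r a -> cont_on r U (D a)) /\
  (forall a, multi_index r a -> forall i, (i < r)%nat -> forall x, U x ->
     derivable_pt_lim (fun t => D a (upd x i t)) (x i) (D (incr a i) x)).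

Definition norm_finite (r : nat) (K : (nat -> R) -> Prop)
    (D : (nat -> nat) -> (nat -> R) -> R) (M : nat -> R) (h : R) : Prop :=
  exists C, forall a, multi_index r a -> forall x, K x ->
    Rabs (D a x) <= C * h ^ (mlen r a) * M (mlen r a).

(* Compact subsets K of the open cube (-1/k,1/k)^r are exactly the subsets of
   the closed cubes [-c,c]^r, 0 < c < 1/k; the seminorm condition is monotone
   in K, so it suffices to quantify over these closed cubes. *)

Definition in_E_Roumieu (r k : nat) (M : R -> nat -> R) (f : (nat -> R) -> R) D : Prop :=
  smooth_with_derivs r (open_cube r k) f D /\
  forall c, 0 < c -> c < / INR k ->
    exists lam, 0 < lam /\ exists h, 0 < h /\ norm_finite r (closed_cube r c) D (M lam) h.

Definition in_E_Beurling (r k : nat) (M : R -> nat -> R) (f : (nat -> R) -> R) D : Prop :=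
  smooth_with_derivs r (open_cube r k) f D /\
  forall c, 0 < c -> c < / INR k ->
    forall lam, 0 < lam -> forall h, 0 < h -> norm_finite r (closed_cube r c) D (M lam) h.

Definition jet_eq (r : nat) (D : (nat -> nat) -> (nat -> R) -> R) (b : (nat -> nat) -> R) : Prop :=
  forall a, multi_index r a -> b a = D a origin / INR (fact (mlen r a)).

Definition jet_image_Roumieu (r : nat) (M : R -> nat -> R) (b : (nat -> nat) -> R) : Prop :=
  exists k f D, (1 <= k)%nat /\ in_E_Roumieu r k M f D /\ jet_eq r D b.

Definition jet_image_Beurling (r : nat) (M : R -> nat -> R) (b : (nat -> nat) -> R) : Prop :=
  exists k f D, (1 <= k)%nat /\ in_E_Beurling r k M f D /\ jet_eq r D b.

Definition seq_norm_finite (r : nat) (N : nat -> R) (h : R) (b : (nat -> nat) -> R) : Prop :=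
  exists C, forall a, multi_index r a ->
    Rabs (b a) <= C * h ^ (mlen r a) * small N (mlen r a).

Definition Lambda_Roumieu (r : nat) (N : R -> nat -> R) (b : (nat -> nat) -> R) : Prop :=
  exists lam, 0 < lam /\ exists h, 0 < h /\ seq_norm_finite r (N lam) h b.

Definition Lambda_Beurling (r : nat) (N : R -> nat -> R) (b : (nat -> nat) -> R) : Prop :=
  forall lam, 0 < lam -> forall h, 0 < h -> seq_norm_finite r (N lam) h b.

(* Main.v *)
(** A germ of a quasianalytic class whose jet at [0] is nonnegative along some
    coordinate axis has a convergent Taylor series along that axis; so every
    nonnegative sequence with zero radius of convergence that satisfies the
    [n^(lam)] bounds yields a jet outside the image of the Borel map.

    The convergence is a one-sided form of Bang's argument.  Let [F p] be the
    [p]-th derivative along the axis and [|F p| <= e^-p W p].  If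
    [F j >= - e^-(k+1) W j] for all [j] at a point, then [F j >= - e^-k W j]
    for all [j] on the interval of length [W k / W (k+1)] to its right.  These
    lengths have a divergent sum, so, starting from [F j 0 >= 0], every point is
    reached with an arbitrarily large [k], which gives [F j >= 0].  Taylor's
    formula then bounds [F p 0 * t^p / p!] by [F 0 t].

    In the Roumieu case [n^(1)] itself has zero radius of convergence; in the
    Beurling case so has [J(k)^k], where [J] tends to infinity slowly enough. *)

Require Import Defs.
From Stdlib Require Import Reals Arith Lra Lia.
From Stdlib Require Import FunctionalExtensionality ClassicalEpsilon.
From Coquelicot Require Import Coquelicot.
Open Scope R_scope.

(** * Weight sequences *)

Definition log_convex (W : nat -> R) : Prop :=
  forall p, W (S p) ^ 2 <= W p * W (S (S p)).

Lemma log_convex_ratio_le (W : nat -> R) (j k : nat) :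
  (forall p, 0 < W p) -> log_convex W -> (j <= k)%nat ->
  W (S j) / W j <= W (S k) / W k.
Proof.
  intros W_pos W_lc Hjk; induction Hjk as [| k _ IH]; [lra |].
  apply Rle_trans with (1 := IH).
  apply Rle_div_l; [apply W_pos |].
  replace (W (S (S k)) / W (S k) * W k) with (W k * W (S (S k)) / W (S k))
    by (field; apply Rgt_not_eq, W_pos).
  apply Rle_div_r; [apply W_pos |].
  specialize (W_lc k); lra.
Qed.

Lemma log_convex_geometric_scale (W : nat -> R) (C h : R) :
  log_convex W -> log_convex (fun p => C * h ^ p * W p).
Proof.
  intros W_lc p.
  replace ((C * h ^ S p * W (S p)) ^ 2)
    with ((C * h ^ S p) ^ 2 * W (S p) ^ 2) by ring.
  replace (C * h ^ p * W p * (C * h ^ S (S p) * W (S (S p))))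
    with ((C * h ^ S p) ^ 2 * (W p * W (S (S p)))) by (simpl; ring).
  apply Rmult_le_compat_l; [apply pow2_ge_0 | apply W_lc].
Qed.

Lemma quasianalytic_geometric_scale (W : nat -> R) (C h : R) :
  (forall p, 0 < W p) -> 0 < C -> 0 < h ->
  quasianalytic W -> quasianalytic (fun p => C * h ^ p * W p).
Proof.
  intros W_pos HC Hh W_qa B; destruct (W_qa (h * B)) as [n Hn]; exists n.
  apply Rmult_lt_reg_l with h; [easy |].
  rewrite scal_sum.
  replace (sum_f_R0 _ n) with (sum_f_R0 (fun k => W k / W (S k)) n); [easy |].
  apply sum_eq; intros k _; simpl.
  assert (0 < h ^ k) by now apply pow_lt.
  specialize (W_pos (S k)); field; repeat split; lra.
Qed.

Lemma weight_sequence_log_convex (N : nat -> R) : weight_sequence N -> log_convex N.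
Proof.
  intros (_ & _ & _ & N_lc & _) p.
  specialize (N_lc (S p) ltac:(lia)).
  replace (S p - 1)%nat with p in N_lc by lia.
  now replace (S p + 1)%nat with (S (S p)) in N_lc by lia.
Qed.

Lemma small_pos (N : nat -> R) (p : nat) : weight_sequence N -> 0 < small N p.
Proof.
  intros [N_pos _]; apply Rdiv_lt_0_compat; [apply N_pos | apply INR_fact_lt_0].
Qed.

Lemma small_le (M N : nat -> R) (p : nat) : M p <= N p -> small M p <= small N p.
Proof.
  intros H; apply Rmult_le_compat_r; [| easy].
  left; apply Rinv_0_lt_compat, INR_fact_lt_0.
Qed.

(** * Towers of derivatives *)

Definition derivative_tower (a b : R) (F : nat -> R -> R) : Prop :=
  forall p t, a <= t <= b -> derivable_pt_lim (F p) t (F (S p) t).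

Definition absolutely_monotone (a b : R) (F : nat -> R -> R) : Prop :=
  forall p t, a <= t <= b -> 0 <= F p t.

Lemma nonneg_derivative_le (f f' : R -> R) (a b : R) :
  a <= b ->
  (forall t, a <= t <= b -> derivable_pt_lim f t (f' t)) ->
  (forall t, a <= t <= b -> 0 <= f' t) ->
  f a <= f b.
Proof.
  intros [Hab | ->] Hd Hf'; [| lra].
  destruct (MVT_cor2 f f' a b Hab Hd) as [t [Ht Hin]].
  assert (0 <= f' t) by (apply Hf'; lra).
  nra.
Qed.

Lemma exp_le (x y : R) : x <= y -> exp x <= exp y.
Proof. intros [H | ->]; [left; now apply exp_increasing | lra]. Qed.

Lemma exp_ge_1 (x : R) : 0 <= x -> 1 <= exp x.
Proof. intros Hx; generalize (exp_ineq1_le x); lra. Qed.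

Lemma tower_exp_lower_bound (n : nat) (a b mu : R) (F : nat -> R -> R) (W : nat -> R) :
  0 <= mu -> (forall j, 0 <= W j) -> derivative_tower a b F ->
  (forall j, (j < n)%nat -> W (S j) <= mu * W j) ->
  (forall j, (j < n)%nat -> - W j <= F j a) ->
  (forall t, a <= t <= b -> - W n <= F n t) ->
  forall t, a <= t <= b -> - (W 0%nat * exp (mu * (t - a))) <= F 0%nat t.
Proof.
  intros Hmu; revert F W; induction n as [| n IH];
    intros F W W_ge0 HF HW Ha Hn t Ht.
  - specialize (Hn t Ht); specialize (W_ge0 0%nat).
    assert (1 <= exp (mu * (t - a))) by (apply exp_ge_1, Rmult_le_pos; lra).
    nra.
  - set (E := fun s => exp (mu * (s - a))).
    assert (HF1 : forall s, a <= s <= b -> - (W 1%nat * E s) <= F 1%nat s).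
    { apply IH with (F := fun j => F (S j)) (W := fun j => W (S j)); auto.
      - intros j; apply HF.
      - intros j Hj; apply HW; lia.
      - intros j Hj; apply Ha; lia. }
    assert (Hincr : F 0%nat a + W 0%nat * E a <= F 0%nat t + W 0%nat * E t).
    { apply nonneg_derivative_le with
        (f := fun s => F 0%nat s + W 0%nat * E s)
        (f' := fun s => F 1%nat s + W 0%nat * (mu * E s)); [lra | |]; intros s Hs.
      - apply derivable_pt_lim_plus; [apply HF; lra |].
        apply is_derive_Reals; unfold E; auto_derive; [easy | unfold Rminus; ring].
      - specialize (HF1 s ltac:(lra)); specialize (HW 0%nat ltac:(lia)).
        assert (0 < E s) by apply exp_pos.
        nra. }
    specialize (Ha 0%nat ltac:(lia)).
    unfold E in Hincr at 1.
    rewrite Rminus_diag, Rmult_0_r, exp_0 in Hincr.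
    unfold E in Hincr; lra.
Qed.

Lemma absolutely_monotone_taylor_le (n : nat) (a b t : R) (F : nat -> R -> R) :
  derivative_tower a b F -> absolutely_monotone a b F -> a <= t <= b ->
  F n a / INR (fact n) * (t - a) ^ n <= F 0%nat t.
Proof.
  revert F t; induction n as [| n IH]; intros F t HF F_ge0 Ht.
  - simpl; replace (F 0%nat a / 1 * 1) with (F 0%nat a) by field.
    apply nonneg_derivative_le with (f' := F 1%nat); [lra | |];
      intros s Hs; [apply HF | apply F_ge0]; lra.
  - set (K := F (S n) a / INR (fact (S n))).
    assert (Hincr : F 0%nat a - K * (a - a) ^ S n <= F 0%nat t - K * (t - a) ^ S n).
    { apply nonneg_derivative_le with
        (f := fun s => F 0%nat s - K * (s - a) ^ S n)
        (f' := fun s => F 1%nat s - F (S n) a / INR (fact n) * (s - a) ^ n);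
        [lra | |]; intros s Hs.
      - apply derivable_pt_lim_minus; [apply HF; lra |].
        apply is_derive_Reals; auto_derive; [easy |].
        unfold K; rewrite fact_simpl, mult_INR.
        change (match n with O => 1 | S _ => INR n + 1 end) with (INR (S n)).
        simpl pred; unfold Rminus.
        field; split; [apply INR_fact_neq_0 | now apply not_0_INR].
      - assert (H : F (S n) a / INR (fact n) * (s - a) ^ n <= F 1%nat s).
        { apply IH with (F := fun p => F (S p)); [| | lra];
            intros p; [apply HF | apply F_ge0]. }
        lra. }
    rewrite Rminus_diag, pow_ne_zero, Rmult_0_r in Hincr by easy.
    specialize (F_ge0 0%nat a ltac:(lra)); lra.
Qed.

Lemma absolutely_monotone_CV_radius (a b : R) (F : nat -> R -> R) :
  a <= b -> derivative_tower a b F -> absolutely_monotone a b F ->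
  Rbar_le (b - a) (CV_radius (fun n => F n a / INR (fact n))).
Proof.
  intros Hab HF F_ge0.
  apply CV_radius_bounded; exists (F 0%nat b); intros n.
  rewrite Rabs_pos_eq.
  - apply absolutely_monotone_taylor_le with b; [easy | easy | lra].
  - apply Rmult_le_pos; [| apply pow_le; lra].
    apply Rdiv_le_0_compat; [apply F_ge0; lra | apply INR_fact_lt_0].
Qed.

(** * Bang's argument for negative parts *)

Section Bang.

Variables (a b : R) (F : nat -> R -> R) (W : nat -> R).
Hypothesis F_tower : derivative_tower a b F.
Hypothesis W_pos : forall p, 0 < W p.
Hypothesis W_log_convex : log_convex W.
Hypothesis F_bound : forall p t, a <= t <= b -> Rabs (F p t) <= W p / exp 1 ^ p.
Hypothesis F_a_ge0 : forall p, 0 <= F p a.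

Definition negpart_le (k : nat) (x : R) : Prop :=
  forall j, - (W j / exp 1 ^ k) <= F j x.

Lemma weight_div_exp_pos (j k : nat) : 0 < W j / exp 1 ^ k.
Proof. apply Rdiv_lt_0_compat; [apply W_pos | apply pow_lt, exp_pos]. Qed.

Lemma negpart_le_start (k : nat) : negpart_le k a.
Proof. intros j; generalize (weight_div_exp_pos j k) (F_a_ge0 j); lra. Qed.

Lemma negpart_le_high_order (j k : nat) (t : R) :
  a <= t <= b -> (k <= j)%nat -> - (W j / exp 1 ^ k) <= F j t.
Proof.
  intros Ht Hkj.
  generalize (F_bound j t Ht); intros H; apply Rabs_le_between in H.
  enough (W j / exp 1 ^ j <= W j / exp 1 ^ k) by lra.
  apply Rmult_le_compat_l; [left; apply W_pos |].
  apply Rinv_le_contravar; [apply pow_lt, exp_pos |].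
  apply Rle_pow; [apply exp_ge_1; lra | easy].
Qed.

Lemma negpart_le_step (k : nat) (z x : R) :
  a <= z -> z <= x -> x <= b -> x - z <= W k / W (S k) ->
  negpart_le (S k) z -> negpart_le k x.
Proof.
  intros Haz Hzx Hxb Hstep Hz j.
  destruct (le_lt_dec k j) as [Hkj | Hjk]; [apply negpart_le_high_order; [lra | easy] |].
  set (mu := W (S k) / W k).
  assert (Hmu : 0 < mu) by (apply Rdiv_lt_0_compat; apply W_pos).
  assert (Hgrow : - (W j / exp 1 ^ S k * exp (mu * (x - z))) <= F j x).
  { apply tower_exp_lower_bound with (n := (S k - j)%nat) (b := x)
      (F := fun i => F (i + j)%nat) (W := fun i => W (i + j)%nat / exp 1 ^ S k);
      [lra | | | | | | lra].
    - intros i; left; apply weight_div_exp_pos.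
    - intros i t Ht; apply F_tower; lra.
    - intros i Hi; unfold Rdiv at 1 2; rewrite <- Rmult_assoc.
      apply Rmult_le_compat_r;
        [left; apply Rinv_0_lt_compat, pow_lt, exp_pos |].
      apply Rle_div_l; [apply W_pos |].
      apply log_convex_ratio_le; [easy | easy | lia].
    - intros i _; apply Hz.
    - intros t Ht; apply negpart_le_high_order; [lra | lia]. }
  apply Rle_trans with (2 := Hgrow), Ropp_le_contravar.
  assert (Hexp : exp (mu * (x - z)) <= exp 1).
  { apply exp_le.
    apply Rle_trans with (mu * (W k / W (S k))).
    - apply Rmult_le_compat_l; lra.
    - right; unfold mu; field; split; apply Rgt_not_eq, W_pos. }
  replace (W j / exp 1 ^ k) with (W j / exp 1 ^ S k * exp 1).
  - apply Rmult_le_compat_l; [left; apply weight_div_exp_pos | easy].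
  - simpl; field; split;
      [apply pow_nonzero, Rgt_not_eq, exp_pos | apply Rgt_not_eq, exp_pos].
Qed.

Let reach : nat -> R := sum_f_R0 (fun k => W k / W (S k)).

Lemma negpart_le_reach (d k : nat) (x : R) :
  a <= x <= b -> x - a <= reach (k + d) - reach k -> negpart_le (S k) x.
Proof.
  revert k x; induction d as [| d IH]; intros k x Hx Hreach.
  - rewrite Nat.add_0_r in Hreach.
    replace x with a by lra; apply negpart_le_start.
  - set (l := W (S k) / W (S (S k))).
    assert (Hl : 0 < l) by (apply Rdiv_lt_0_compat; apply W_pos).
    destruct (Rle_lt_dec (x - l) a) as [Hnear | Hfar].
    + apply negpart_le_step with a; fold l; try lra; apply negpart_le_start.
    + apply negpart_le_step with (x - l); fold l; try lra.
      apply IH; [lra |].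
      rewrite Nat.add_succ_r in Hreach.
      unfold reach in *; rewrite (tech5 _ k); fold l; simpl in *; lra.
Qed.

Lemma negpart_le_everywhere (k : nat) (x : R) :
  quasianalytic W -> a <= x <= b -> negpart_le (S k) x.
Proof.
  intros W_qa Hx.
  destruct (W_qa (x - a + reach k)) as [n Hn]; fold (reach n) in Hn.
  apply negpart_le_reach with n; [easy |].
  assert (Hgrowing : Un_growing reach).
  { intros m; unfold reach; simpl.
    assert (0 < W (S m) / W (S (S m))) by (apply Rdiv_lt_0_compat; apply W_pos).
    lra. }
  assert (Hkn := growing_prop reach (k + n) n Hgrowing ltac:(lia)).
  lra.
Qed.

Lemma bang_absolutely_monotone : quasianalytic W -> absolutely_monotone a b F.
Proof.
  intros W_qa p x Hx.
  destruct (Rle_lt_dec 0 (F p x)) as [| Hneg]; [easy | exfalso].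
  assert (He : Rabs (exp 1) > 1).
  { rewrite Rabs_pos_eq by (left; apply exp_pos).
    generalize (exp_ineq1 1 R1_neq_R0); lra. }
  destruct (Pow_x_infinity (exp 1) He ((W p + 1) / - F p x)) as [k Hk].
  specialize (Hk (S k) ltac:(lia)).
  assert (HeS : 0 < exp 1 ^ S k) by apply pow_lt, exp_pos.
  rewrite Rabs_pos_eq in Hk by lra.
  apply Rge_le, (proj1 (Rle_div_l _ _ (- F p x) ltac:(lra))) in Hk.
  assert (Hlow := negpart_le_everywhere k x W_qa Hx p).
  enough (W p / exp 1 ^ S k < - F p x) by lra.
  apply Rlt_div_l; lra.
Qed.

End Bang.

Lemma quasianalytic_absolutely_monotone
    (a b C h : R) (M : nat -> R) (F : nat -> R -> R) :
  (forall p, 0 < M p) -> log_convex M -> quasianalytic M -> 0 < C -> 0 < h ->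
  derivative_tower a b F ->
  (forall p t, a <= t <= b -> Rabs (F p t) <= C * h ^ p * M p) ->
  (forall p, 0 <= F p a) ->
  absolutely_monotone a b F.
Proof.
  intros M_pos M_lc M_qa HC Hh F_tower F_bound F_a_ge0.
  assert (Heh : 0 < h * exp 1) by (apply Rmult_lt_0_compat; [easy | apply exp_pos]).
  apply bang_absolutely_monotone with (W := fun p => C * (h * exp 1) ^ p * M p).
  - easy.
  - intros p; repeat apply Rmult_lt_0_compat; [easy | now apply pow_lt | apply M_pos].
  - now apply log_convex_geometric_scale.
  - intros p t Ht.
    replace (C * (h * exp 1) ^ p * M p / exp 1 ^ p) with (C * h ^ p * M p);
      [now apply F_bound |].
    rewrite Rpow_mult_distr.
    field; apply pow_nonzero, Rgt_not_eq, exp_pos.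
  - easy.
  - now apply quasianalytic_geometric_scale.
Qed.

(** * Restriction to a coordinate axis *)

Definition axis_index (i p : nat) : nat -> nat := Nat.iter p (fun a => incr a i) mzero.

Definition axis_point (i : nat) (t : R) : nat -> R := upd origin i t.

Lemma multi_index_axis (r i p : nat) : (i < r)%nat -> multi_index r (axis_index i p).
Proof.
  intros Hi; induction p as [| p IH]; intros j Hj; [easy |].
  simpl; unfold incr; destruct (Nat.eqb_spec j i); [lia | now apply IH].
Qed.

Lemma mlen_incr (r i : nat) (a : nat -> nat) :
  mlen r (incr a i) = ((if i <? r then 1 else 0) + mlen r a)%nat.
Proof.
  induction r as [| r IH]; [easy |].
  simpl; rewrite IH; unfold incr.
  destruct (Nat.eqb_spec r i), (Nat.ltb_spec i r), (Nat.ltb_spec i (S r)); lia.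
Qed.

Lemma mlen_axis (r i p : nat) : (i < r)%nat -> mlen r (axis_index i p) = p.
Proof.
  intros Hi; induction p as [| p IH]; simpl.
  - clear Hi; induction r as [| r IH]; easy.
  - rewrite mlen_incr, IH; now apply Nat.ltb_lt in Hi as ->.
Qed.

Lemma upd_axis_point (i : nat) (s t : R) : upd (axis_point i s) i t = axis_point i t.
Proof.
  apply functional_extensionality; intros j; unfold axis_point, upd.
  now destruct (Nat.eqb j i).
Qed.

Lemma axis_point_0 (i : nat) : axis_point i 0 = origin.
Proof.
  apply functional_extensionality; intros j; unfold axis_point, upd, origin.
  now destruct (Nat.eqb j i).
Qed.

Lemma closed_cube_axis_point (r i : nat) (c t : R) :
  (i < r)%nat -> Rabs t <= c -> closed_cube r c (axis_point i t).
Proof.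
  intros Hi Ht; split; intros j Hj; unfold axis_point, upd, origin;
    destruct (Nat.eqb_spec j i); try easy; [lia |].
  rewrite Rabs_R0; apply Rle_trans with (2 := Ht), Rabs_pos.
Qed.

Lemma closed_cube_open_cube (r k : nat) (c : R) (x : nat -> R) :
  c < / INR k -> closed_cube r c x -> open_cube r k x.
Proof.
  intros Hc [Hx Hle]; split; [easy |].
  intros i Hi; apply Rle_lt_trans with (2 := Hc); auto.
Qed.

Lemma smooth_axis_tower (r i : nat) (U : (nat -> R) -> Prop) (f : (nat -> R) -> R)
    (D : (nat -> nat) -> (nat -> R) -> R) (a b : R) :
  (i < r)%nat -> smooth_with_derivs r U f D ->
  (forall t, a <= t <= b -> U (axis_point i t)) ->
  derivative_tower a b (fun p t => D (axis_index i p) (axis_point i t)).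
Proof.
  intros Hi (_ & _ & HD) HU p t Ht.
  assert (H := HD _ (multi_index_axis r i p Hi) i Hi _ (HU t Ht)).
  replace (axis_point i t i) with t in H
    by (unfold axis_point, upd; now rewrite Nat.eqb_refl).
  replace (fun s => D (axis_index i p) (upd (axis_point i t) i s))
    with (fun s => D (axis_index i p) (axis_point i s)) in H; [exact H |].
  apply functional_extensionality; intros s; now rewrite upd_axis_point.
Qed.

Lemma norm_finite_axis (r i : nat) (K : (nat -> R) -> Prop)
    (D : (nat -> nat) -> (nat -> R) -> R) (M : nat -> R) (h : R) :
  (i < r)%nat -> (forall p, 0 < M p) -> 0 < h -> norm_finite r K D M h ->
  exists C, 0 < C /\ forall p x, K x -> Rabs (D (axis_index i p) x) <= C * h ^ p * M p.
Proof.
  intros Hi M_pos Hh [C HC]; exists (Rmax C 1); split.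
  - apply Rlt_le_trans with 1; [lra | apply Rmax_r].
  - intros p x Hx.
    specialize (HC _ (multi_index_axis r i p Hi) x Hx); rewrite mlen_axis in HC by easy.
    apply Rle_trans with (1 := HC).
    apply Rmult_le_compat_r; [left; apply M_pos |].
    apply Rmult_le_compat_r; [left; now apply pow_lt | apply Rmax_l].
Qed.

Lemma nonneg_jet_CV_radius_pos (r i : nat) (M : R -> nat -> R) (b : (nat -> nat) -> R) :
  (i < r)%nat -> weight_matrix M -> quasianalytic_matrix M ->
  jet_image_Roumieu r M b -> (forall p, 0 <= b (axis_index i p)) ->
  Rbar_lt 0 (CV_radius (fun p => b (axis_index i p))).
Proof.
  intros Hi [HM _] HMq (k & f & D & Hk & [Hsmooth HE] & Hjet) b_ge0.
  assert (Hik : 0 < / INR k) by (apply Rinv_0_lt_compat, lt_0_INR; lia).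
  set (c := / INR k / 2).
  assert (Hc : 0 < c < / INR k) by (unfold c; lra).
  destruct (HE c) as (lam & Hlam & h & Hh & Hnorm); [easy | easy |].
  assert (M_pos := proj1 (HM lam Hlam)).
  destruct (norm_finite_axis r i _ D (M lam) h Hi M_pos Hh Hnorm) as (C & HC & Hbound).
  assert (Hcube : forall t, 0 <= t <= c -> closed_cube r c (axis_point i t))
    by (intros t Ht; apply closed_cube_axis_point; [easy | rewrite Rabs_pos_eq; lra]).
  set (F := fun p t => D (axis_index i p) (axis_point i t)).
  assert (F_tower : derivative_tower 0 c F).
  { apply smooth_axis_tower with r (open_cube r k) f; [easy | easy |].
    intros t Ht; apply closed_cube_open_cube with c; [easy | now apply Hcube]. }
  assert (b_axis : forall p, b (axis_index i p) = F p 0 / INR (fact p)).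
  { intros p; rewrite (Hjet _ (multi_index_axis r i p Hi)), mlen_axis by easy.
    unfold F; now rewrite axis_point_0. }
  assert (F_ge0 : absolutely_monotone 0 c F).
  { apply quasianalytic_absolutely_monotone with C h (M lam); auto.
    - now apply weight_sequence_log_convex, HM.
    - intros p t Ht; now apply Hbound, Hcube.
    - intros p; specialize (b_ge0 p); rewrite b_axis in b_ge0.
      apply Rle_div_r in b_ge0; [lra | apply INR_fact_lt_0]. }
  rewrite (CV_radius_ext _ _ b_axis).
  apply Rbar_lt_le_trans with (c - 0); [simpl; lra |].
  apply absolutely_monotone_CV_radius; [lra | easy | easy].
Qed.

(** * Radial jets *)

Definition radial_jet (r : nat) (s : nat -> R) : (nat -> nat) -> R :=
  fun a => s (mlen r a).

Lemma radial_jet_not_jet_image (r : nat) (M : R -> nat -> R) (s : nat -> R) :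
  (1 <= r)%nat -> weight_matrix M -> quasianalytic_matrix M ->
  (forall p, 0 <= s p) -> CV_radius s = 0 ->
  ~ jet_image_Roumieu r M (radial_jet r s).
Proof.
  intros Hr HM HMq s_ge0 Hs Hjet.
  assert (Hpos : Rbar_lt 0 (CV_radius (fun p => radial_jet r s (axis_index 0 p)))).
  { apply nonneg_jet_CV_radius_pos with r M; auto.
    intros p; apply s_ge0. }
  rewrite (CV_radius_ext _ s), Hs in Hpos; [simpl in Hpos; lra |].
  intros p; unfold radial_jet; now rewrite mlen_axis.
Qed.

Lemma jet_image_Beurling_Roumieu (r : nat) (M : R -> nat -> R) (b : (nat -> nat) -> R) :
  jet_image_Beurling r M b -> jet_image_Roumieu r M b.
Proof.
  intros (k & f & D & Hk & [Hsmooth HE] & Hjet); exists k, f, D.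
  repeat split; try easy; try apply Hsmooth.
  intros c Hc Hck; exists 1; split; [lra |]; exists 1; split; [lra |].
  apply HE; auto; lra.
Qed.

Lemma eventually_le_multiple (u v : nat -> R) (C0 : R) :
  (forall k, 0 < v k) -> eventually (fun k => u k <= C0 * v k) ->
  exists C, forall k, u k <= C * v k.
Proof.
  intros v_pos [K HK]; revert C0 HK; induction K as [| K IH]; intros C0 HK.
  - exists C0; intros k; apply HK; lia.
  - apply (IH (Rmax C0 (u K / v K))); intros k Hk.
    destruct (Nat.eq_dec k K) as [-> | Hne].
    + apply Rle_div_l; [apply v_pos | apply Rmax_r].
    + apply Rle_trans with (C0 * v k); [apply HK; lia |].
      apply Rmult_le_compat_r; [left; apply v_pos | apply Rmax_l].
Qed.

Lemma seq_norm_finite_radial (r : nat) (N : nat -> R) (h : R) (s : nat -> R) :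
  weight_sequence N -> 0 < h ->
  eventually (fun p => Rabs (s p) <= h ^ p * small N p) ->
  seq_norm_finite r N h (radial_jet r s).
Proof.
  intros HN Hh Hs.
  destruct (eventually_le_multiple (fun p => Rabs (s p)) (fun p => h ^ p * small N p) 1)
    as [C HC].
  - intros p; apply Rmult_lt_0_compat; [now apply pow_lt | now apply small_pos].
  - revert Hs; apply filter_imp; intros p; lra.
  - exists C; intros a _; rewrite Rmult_assoc; apply HC.
Qed.

(** * Sequences with zero radius of convergence *)

Lemma CV_radius_eq_0 (s : nat -> R) :
  (forall B, 0 < B -> exists k, (1 <= k)%nat /\ B ^ k <= Rabs (s k)) -> CV_radius s = 0.
Proof.
  intros Hs; apply Rbar_le_antisym; [| apply CV_radius_ge_0].
  apply CV_radius_bounded; intros rho [C HC].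
  destruct (Rle_lt_dec rho 0) as [| Hrho]; [easy | exfalso].
  assert (HC0 : 0 <= C) by (apply Rle_trans with (2 := HC 0%nat), Rabs_pos).
  destruct (Hs ((C + 1) / rho)) as (k & Hk & Hsk); [apply Rdiv_lt_0_compat; lra |].
  specialize (HC k); rewrite Rabs_mult, (Rabs_pos_eq (rho ^ k)) in HC
    by (apply pow_le; lra).
  assert (Hge : (C + 1) ^ k <= Rabs (s k) * rho ^ k).
  { replace (C + 1) with ((C + 1) / rho * rho) by (field; lra).
    rewrite Rpow_mult_distr; apply Rmult_le_compat_r; [apply pow_le; lra | easy]. }
  assert (Hpow := Rle_pow (C + 1) 1 k ltac:(lra) Hk); rewrite pow_1 in Hpow.
  lra.
Qed.

Lemma CV_radius_pow_diverging (u : nat -> R) :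
  is_lim_seq u p_infty -> CV_radius (fun k => u k ^ k) = 0.
Proof.
  intros Hu; apply CV_radius_eq_0; intros B HB.
  apply is_lim_seq_spec in Hu; destruct (Hu B) as [K HK].
  exists (S K); split; [lia |].
  specialize (HK (S K) ltac:(lia)).
  apply Rle_trans with (2 := Rle_abs _), pow_incr; lra.
Qed.

Lemma pow_lt_Rpower_inv (B x : R) (k : nat) :
  0 < B -> 0 < x -> (1 <= k)%nat -> B < Rpower x (/ INR k) -> B ^ k < x.
Proof.
  intros HB Hx Hk H.
  assert (HkR : 0 < INR k) by (apply lt_0_INR; lia).
  rewrite <- Rpower_pow by easy.
  replace x with (Rpower (Rpower x (/ INR k)) (INR k)) at 1.
  - apply Rlt_Rpower_l; lra.
  - rewrite Rpower_mult, Rinv_l, Rpower_1 by lra; easy.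
Qed.

Definition roots_unbounded (s : nat -> R) : Prop :=
  forall B : R, exists k, (1 <= k)%nat /\ B < Rpower (s k) (/ INR k).

Definition roots_diverge (s : nat -> R) : Prop :=
  forall B : R, exists K, forall k, (K <= k)%nat -> (1 <= k)%nat ->
    B < Rpower (s k) (/ INR k).

Lemma CV_radius_roots_unbounded (s : nat -> R) :
  (forall k, 0 < s k) -> roots_unbounded s -> CV_radius s = 0.
Proof.
  intros s_pos Hs; apply CV_radius_eq_0; intros B HB.
  destruct (Hs B) as (k & Hk & HBk); exists k; split; [easy |].
  apply Rle_trans with (2 := Rle_abs _); left; now apply pow_lt_Rpower_inv.
Qed.

Lemma roots_diverge_pow_lt (s : nat -> R) (B : R) :
  (forall k, 0 < s k) -> roots_diverge s -> 0 < B -> eventually (fun k => B ^ k < s k).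
Proof.
  intros s_pos Hs HB; destruct (Hs B) as [K HK].
  exists (S K); intros k Hk; apply pow_lt_Rpower_inv; [easy | easy | lia | apply HK; lia].
Qed.

Fixpoint last_upto (P : nat -> Prop) (n : nat) : nat :=
  match n with
  | O => O
  | S m => if excluded_middle_informative (P n) then n else last_upto P m
  end.

Lemma last_upto_sat (P : nat -> Prop) (n : nat) :
  (1 <= last_upto P n)%nat -> P (last_upto P n).
Proof.
  induction n as [| n IH]; simpl; [lia |].
  now destruct excluded_middle_informative.
Qed.

Lemma last_upto_ge (P : nat -> Prop) (j n : nat) :
  (j <= n)%nat -> P j -> (j <= last_upto P n)%nat.
Proof.
  induction n as [| n IH]; intros Hj HP; simpl; [lia |].
  destruct excluded_middle_informative as [| HnP]; [easy |].
  apply IH; [| easy].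
  destruct (Nat.eq_dec j (S n)) as [-> |]; [easy | lia].
Qed.

Lemma slow_diagonal (P : nat -> nat -> Prop) :
  (forall j, (1 <= j)%nat -> eventually (P j)) ->
  exists J : nat -> nat,
    is_lim_seq (fun k => INR (J k)) p_infty /\ eventually (fun k => P (J k) k).
Proof.
  intros HP; set (J := fun k => last_upto (fun j => P j k) k).
  assert (Jge : forall j, (1 <= j)%nat -> eventually (fun k => (j <= J k)%nat)).
  { intros j Hj; destruct (HP j Hj) as [K HK].
    exists (j + K)%nat; intros k Hk.
    apply last_upto_ge; [lia | apply HK; lia]. }
  exists J; split.
  - apply is_lim_seq_spec; intros B.
    destruct (INR_unbounded B) as [j Hj].
    generalize (Jge (S j) ltac:(lia)); apply filter_imp; intros k Hk.
    apply le_INR in Hk; rewrite S_INR in Hk; lra.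
  - generalize (Jge 1%nat (le_n 1)); apply filter_imp; intros k Hk.
    now apply last_upto_sat with (P := fun j => P j k).
Qed.

Lemma roots_diverge_diagonal (s : nat -> nat -> R) (B : nat -> R) :
  (forall j, (1 <= j)%nat -> 0 < B j /\ (forall k, 0 < s j k) /\ roots_diverge (s j)) ->
  exists J : nat -> nat,
    is_lim_seq (fun k => INR (J k)) p_infty /\
    eventually (fun k => B (J k) ^ k < s (J k) k).
Proof.
  intros Hs; apply slow_diagonal with (P := fun j k => B j ^ k < s j k).
  intros j Hj; destruct (Hs j Hj) as (HB & s_pos & Hdiv).
  now apply roots_diverge_pow_lt.
Qed.

(** * Jets outside the image *)

Lemma Lambda_Roumieu_CV_radius_0 (r : nat) (N : R -> nat -> R) :
  weight_matrix N -> (forall lam, 0 < lam -> roots_unbounded (small (N lam))) ->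
  exists s, (forall p, 0 <= s p) /\ CV_radius s = 0 /\
    Lambda_Roumieu r N (radial_jet r s).
Proof.
  intros [HN _] Hroots.
  assert (Hpos : forall p, 0 < small (N 1) p) by (intros p; apply small_pos, HN; lra).
  exists (small (N 1)); split; [intros p; now left | split].
  - apply CV_radius_roots_unbounded; [easy | apply Hroots; lra].
  - exists 1; split; [lra |]; exists 1; split; [lra |].
    apply seq_norm_finite_radial; [apply HN; lra | lra |].
    exists 0%nat; intros p _; rewrite pow1, Rmult_1_l, Rabs_pos_eq; [lra | now left].
Qed.

Lemma Lambda_Beurling_CV_radius_0 (r : nat) (N : R -> nat -> R) :
  weight_matrix N -> (forall lam, 0 < lam -> roots_diverge (small (N lam))) ->
  exists s, (forall p, 0 <= s p) /\ CV_radius s = 0 /\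
    Lambda_Beurling r N (radial_jet r s).
Proof.
  intros [HN N_mono] Hroots.
  (* One of the two factors [j ^ k] will absorb the arbitrary [h ^ k] of the norms. *)
  destruct (roots_diverge_diagonal (fun j => small (N (/ INR j)))
    (fun j => INR j * INR j)) as (J & HJ & Hgrowth).
  { intros j Hj.
    assert (HjR : 0 < INR j) by (apply lt_0_INR; lia).
    assert (Hij := Rinv_0_lt_compat _ HjR).
    repeat split; [nra | intros k; now apply small_pos, HN | now apply Hroots]. }
  exists (fun k => INR (J k) ^ k).
  split; [intros p; apply pow_le, pos_INR | split; [now apply CV_radius_pow_diverging |]].
  intros lam Hlam h Hh.
  apply seq_norm_finite_radial; [now apply HN | easy |].
  apply is_lim_seq_spec in HJ.
  generalize (filter_and _ _ (HJ (/ lam + / h)) Hgrowth).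
  apply filter_imp; intros k [Hbig Hk]; set (j := INR (J k)) in *.
  assert (Hil := Rinv_0_lt_compat _ Hlam).
  assert (Hih := Rinv_0_lt_compat _ Hh).
  rewrite Rabs_pos_eq by (apply pow_le; lra).
  apply Rle_trans with (h ^ k * (j * j) ^ k).
  - rewrite <- Rpow_mult_distr; apply pow_incr; split; [lra |].
    assert (1 <= h * j) by (rewrite <- (Rinv_r h) by lra; apply Rmult_le_compat_l; lra).
    nra.
  - apply Rmult_le_compat_l; [left; now apply pow_lt |].
    apply Rle_trans with (1 := Rlt_le _ _ Hk), small_le, N_mono.
    + apply Rinv_0_lt_compat; lra.
    + rewrite <- (Rinv_inv lam); apply Rinv_le_contravar; lra.
Qed.

Theorem mainTheorem10 (r : nat) (Hr : (1 <= r)%nat) (M N : R -> nat -> R)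
  (HM : weight_matrix M) (HN : weight_matrix N)
  (HMq : quasianalytic_matrix M) (HNq : quasianalytic_matrix N) :
  (* Roumieu case *)
  ((forall lam, 0 < lam -> forall B : R,
       exists k, (1 <= k)%nat /\ B < Rpower (small (N lam) k) (/ INR k)) ->
    (exists b, Lambda_Roumieu r N b /\ ~ jet_image_Roumieu r M b) /\
    (exists b, Lambda_Roumieu r N b /\ ~ jet_image_Beurling r M b) /\
    (exists b, Lambda_Roumieu r N b /\ ~ jet_image_Roumieu r N b))
  /\
  (* Beurling case *)
  ((forall lam, 0 < lam -> forall B : R, exists K, forall k, (K <= k)%nat -> (1 <= k)%nat ->
       B < Rpower (small (N lam) k) (/ INR k)) ->
    (exists b, Lambda_Beurling r N b /\ ~ jet_image_Roumieu r M b) /\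
    (exists b, Lambda_Beurling r N b /\ ~ jet_image_Beurling r M b) /\
    (exists b, Lambda_Beurling r N b /\ ~ jet_image_Beurling r N b)).
Proof.
  assert (Hout : forall s L, (forall p, 0 <= s p) -> CV_radius s = 0 ->
    weight_matrix L -> quasianalytic_matrix L ->
    ~ jet_image_Roumieu r L (radial_jet r s) /\
    ~ jet_image_Beurling r L (radial_jet r s)).
  { intros s L s_ge0 Hs HL HLq.
    assert (Hnot := radial_jet_not_jet_image r L s Hr HL HLq s_ge0 Hs).
    split; [easy |]; intros Hjet; now apply Hnot, jet_image_Beurling_Roumieu. }
  split; intros Hn.
  - destruct (Lambda_Roumieu_CV_radius_0 r N HN Hn) as (s & s_ge0 & Hs & Hmem).
    repeat split; exists (radial_jet r s); split; try easy; now apply Hout.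
  - destruct (Lambda_Beurling_CV_radius_0 r N HN Hn) as (s & s_ge0 & Hs & Hmem).
    repeat split; exists (radial_jet r s); split; try easy; now apply Hout.
Qed.
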